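(* Let $n$ be a positive even integer. If there exists an orthogonal array $\mathrm{OA}(N,n,2,\frac n2-1)$, then $$N>\frac{0.409}{n}\cdot 2^n .$$
   Context: An orthogonal array $\mathrm{OA}(N,n,2,t)$ is a nonempty multiset $C$ of $N$ (counted with multiplicity) binary $n$-tuples from $\{0,1\}^n$ such that for any distinct coordinates $i_1,\ldots,i_t\in\{1,\ldots,n\}$ and any $a_1,\ldots,a_t\in\{0,1\}$, the number (with multiplicity) of $(x_1,\ldots,x_n)\in C$ with $x_{i_j}=a_j$, $j=1,\ldots,t$, equals $N/2^t$. *)

(* Defs.v *)
From mathcomp Require Export all_boot all_order all_algebra.
From mathcomp Require Export finmap multiset.

Set Implicit Arguments.
Unset Strict Implicit.
Unset Printing Implicit Defensive.

Import GRing.Theory Num.Theory.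
Local Open Scope mset_scope.
Local Open Scope ring_scope.

(* [size] and [count] act on [enum_mset C], in which each tuple is repeated
   according to its multiplicity. *)
Definition orthogonal_array (N n t : nat) (C : {mset n.-tuple bool}) : Prop :=
  [/\ C <> mset0,
      size C = N &
      forall (i : 'I_t -> 'I_n) (a : 'I_t -> bool), injective i ->
        (count (fun x : n.-tuple bool => [forall j, tnth x (i j) == a j]) C)%:R
          = N%:R / 2 ^+ t :> rat].

(* Main.v *)
Require Import Defs.
From mathcomp Require Import all_boot all_order all_algebra.
From mathcomp Require Import finmap multiset.
From mathcomp Require Import zify ring lra.

Import Order.TTheory GRing.Theory Num.Theory.
Local Open Scope mset_scope.
Local Open Scope ring_scope.

(** Let F(u) be the character sum of the array at u in {0,1}^n, and let
    y(u) = n - 2|u|, which is the sum of the characters of the unit vectors.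
    Products of F and y are sums of characters with nonnegative coefficients,
    so the sum over u of F^2 y (y + n)^2 = F^2 (y^3 + 2 n y^2 + n^2 y) is at
    least that of 2 n F^2 y^2, which is at least 2 n * 2^n n N (diagonal terms
    only).  Conversely F(u) = 0 for 0 < |u| < n/2 by strength n/2 - 1, and
    y(u) <= 0 for |u| >= n/2, so the sum is at most its term at u = 0, namely
    4 n^3 N^2.  Hence N >= 2^n / (2 n). *)

Section Characters.

Variable n : nat.
Implicit Types (a b : 'I_n -> bool) (u : {ffun 'I_n -> bool}).

(** The Walsh character $(-1)^{\langle a,u\rangle}$, with [a] a plain function so that both [tnth x]
    and [eq_op i] can index it. *)
Definition cube_char a u : rat := \prod_i (-1) ^+ (a i && u i).

Lemma cube_charM a b u :
  cube_char a u * cube_char b u = cube_char (fun i => a i (+) b i) u.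
Proof.
rewrite /cube_char -big_split; apply: eq_bigr => i _ /=.
by case: (a i) (b i) (u i) => [] [] []; rewrite /= ?mulr1 ?mul1r ?mulrNN.
Qed.

Lemma cube_char_sqr a u : cube_char a u * cube_char a u = 1.
Proof.
by rewrite cube_charM /cube_char big1 // => i _; rewrite addbb.
Qed.

(** The sum factors over coordinates, each factor being 2 or 0. *)
Lemma sum_cube_char_ge0 a : 0 <= \sum_u cube_char a u.
Proof.
rewrite -(bigA_distr_bigA (fun i (c : bool) => (-1 : rat) ^+ (a i && c))) /=.
apply: prodr_ge0 => i _; rewrite big_bool /= andbT andbF.
by case: (a i); rewrite /= ?expr0 ?expr1.
Qed.

(** All Walsh coefficients of [F], unnormalised, are nonnegative. *)
Definition posdef (F : {ffun 'I_n -> bool} -> rat) : Prop :=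
  forall a, 0 <= \sum_u F u * cube_char a u.

Lemma posdef1 : posdef (fun=> 1).
Proof.
by move=> a; under eq_bigr do rewrite mul1r; apply: sum_cube_char_ge0.
Qed.

Definition char_sum {T : Type} (lab : T -> 'I_n -> bool) (s : seq T) u : rat :=
  \sum_(x <- s) cube_char (lab x) u.

(** Multiplying by one character only translates the Walsh coefficients. *)
Lemma posdef_char_sum T (lab : T -> 'I_n -> bool) s F :
  posdef F -> posdef (fun u => char_sum lab s u * F u).
Proof.
move=> Fpos a.
under eq_bigr do rewrite /char_sum mulr_suml mulr_suml.
rewrite exchange_big; apply: sumr_ge0 => x _ /=.
under eq_bigr do rewrite mulrAC cube_charM mulrC.
exact: Fpos.
Qed.

Lemma posdef_sum_ge0 F : posdef F -> 0 <= \sum_u F u.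
Proof.
move=> /(_ (fun=> false)); congr (0 <= _); apply: eq_bigr => u _.
by rewrite /cube_char big1 ?mulr1.
Qed.

(** In the expanded square, each diagonal pair contributes the sum of [F], since characters square
    to 1; every other pair contributes a Walsh coefficient of [F], which is nonnegative. *)
Lemma char_sum_sqr_ge T (lab : T -> 'I_n -> bool) s F : posdef F ->
  (size s)%:R * \sum_u F u
    <= \sum_u char_sum lab s u * (char_sum lab s u * F u).
Proof.
move=> Fpos.
have step x s' : \sum_u F u + \sum_u char_sum lab s' u * (char_sum lab s' u * F u)
   <= \sum_u char_sum lab (x :: s') u * (char_sum lab (x :: s') u * F u).
  have cross := posdef_char_sum T lab s' F Fpos (lab x).
  have -> : \sum_u char_sum lab (x :: s') u * (char_sum lab (x :: s') u * F u)
    = \sum_u F u + \sum_u char_sum lab s' u * (char_sum lab s' u * F u)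
      + 2 * \sum_u char_sum lab s' u * F u * cube_char (lab x) u.
    rewrite mulr_sumr -!big_split; apply: eq_bigr => u _ /=.
    rewrite /char_sum big_cons; set c := cube_char _ _; set S := \sum_(_ <- _) _.
    rewrite [in RHS](_ : F u + _ = c * c * F u + S * (S * F u)); first by ring.
    by rewrite cube_char_sqr mul1r.
  lra.
elim: s => [|x s IHs].
  by rewrite mul0r sumr_ge0 // => u _; rewrite /char_sum big_nil mul0r.
apply: le_trans (step x s); rewrite /= -natr1 mulrDl mul1r addrC lerD2l.
exact: IHs.
Qed.

Lemma char_sum_units u :
  char_sum (fun i : 'I_n => eq_op i) (enum 'I_n) u
    = n%:R - 2 * #|[set i | u i]|%:R.
Proof.
rewrite /char_sum big_enum /=.
have -> : (n%:R : rat) = \sum_(i < n) 1 by rewrite sumr_const card_ord.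
rewrite -sum1_card natr_sum mulr_sumr.
rewrite [X in _ - X]big_mkcond -sumrB; apply: eq_bigr => i _.
rewrite /cube_char (bigD1 i) //= eqxx inE big1 ?mulr1; last first.
  by move=> j; rewrite eq_sym => /negbTE ->.
by case: (u i); rewrite ?expr1 ?expr0 //; ring.
Qed.

End Characters.

Arguments cube_char {n}.
Arguments posdef {n}.
Arguments char_sum {n T}.

(** The array is uniform on any [t] coordinates containing the support of [u], and a nontrivial
    character sums to zero over $\{0,1\}^t$. *)
Lemma OA_char_sum_eq0 (N n t : nat) (C : {mset n.-tuple bool})
    (u : {ffun 'I_n -> bool}) :
  (t <= n)%N -> orthogonal_array N t C -> (0 < #|[set i | u i]| <= t)%N ->
  char_sum (fun x : n.-tuple bool => tnth x) C u = 0.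
Proof.
move=> le_tn [_ _ OA] /andP[U_gt0 U_le].
set U := [set i | u i] in U_gt0 U_le.
(* Listing the support first puts all of it among the first [t] entries, as [U] has at most [t]
   elements; later entries give factors 1. *)
pose p := enum U ++ enum (~: U).
have p_perm : perm_eq p (enum 'I_n).
  apply: uniq_perm; rewrite ?enum_uniq //.
    rewrite cat_uniq !enum_uniq /= andbT; apply/hasPn => i.
    by rewrite !mem_enum inE.
  by move=> i; rewrite mem_cat !mem_enum in_setC orbN.
have size_p : size p = n by rewrite (perm_size p_perm) size_enum_ord.
have [i0 i0U] : exists i0, i0 \in U by apply/set0Pn; rewrite -card_gt0.
pose i (j : 'I_t) := nth i0 p j.
have lt_p (j : 'I_t) : (j < size p)%N by rewrite size_p (leq_trans (ltn_ord j)).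
have i_inj : injective i.
  move=> j k /eqP; rewrite nth_uniq ?lt_p //; first by move/eqP/val_inj.
  by rewrite (perm_uniq p_perm) enum_uniq.
have charE (x : n.-tuple bool) :
    cube_char (tnth x) u = \prod_(j < t) (-1) ^+ (tnth x (i j) && u (i j)).
  rewrite /cube_char -big_enum /= -(perm_big _ p_perm) /=.
  rewrite -(cat_take_drop t p) big_cat /= [X in _ * X]big1_seq ?mulr1; last first.
    move=> k /andP[_]; rewrite /p drop_cat -cardE ltnNge U_le /= => /mem_drop.
    by rewrite mem_enum !inE => /negbTE ->; rewrite andbF.
  rewrite (big_nth i0) size_take size_p big_mkord.
  have -> : (if (t < n)%N then t else n) = t by case: ltnP => //; lia.
  by apply: eq_bigr => j _; rewrite nth_take.
(* Tuples are grouped by their pattern on the chosen coordinates; each pattern occurs $N/2^t$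
   times. *)
pose row (x : n.-tuple bool) : {ffun 'I_t -> bool} := [ffun j => tnth x (i j)].
transitivity (\sum_(a : {ffun 'I_t -> bool})
    N%:R / 2 ^+ t * \prod_(j < t) (-1 : rat) ^+ (a j && u (i j))).
  rewrite /char_sum (eq_bigr (fun x : n.-tuple bool =>
    \sum_(a | row x == a) \prod_(j < t) (-1 : rat) ^+ (a j && u (i j)))); last first.
    move=> x _; rewrite (big_pred1 (row x)); last by move=> a; rewrite eq_sym.
    by rewrite charE; apply: eq_bigr => j _; rewrite ffunE.
  under eq_bigr do rewrite big_mkcond.
  rewrite exchange_big; apply: eq_bigr => a _ /=.
  rewrite -big_mkcond /= -(OA i a i_inj) big_const_seq iter_addr_0 mulr_natl.
  congr (_ *+ _); apply: eq_count => x.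
  apply/eqP/forallP => [<- j|eq_xa]; first by rewrite ffunE.
  by apply/ffunP=> j; rewrite ffunE; apply/eqP.
rewrite -mulr_sumr.
rewrite -(bigA_distr_bigA (fun j (c : bool) => (-1 : rat) ^+ (c && u (i j)))) /=.
have t_gt0 : (0 < t)%N by apply: leq_trans U_le.
(* The first listed coordinate lies in [U], so its factor is $-1+1=0$. *)
rewrite (bigD1 (Ordinal t_gt0)) //= big_bool /=.
have -> : u (i (Ordinal t_gt0)).
  have: i (Ordinal t_gt0) \in U; last by rewrite inE.
  by rewrite /i nth_cat -cardE /= U_gt0 -mem_enum mem_nth // -cardE.
by rewrite /= expr1 expr0 addNr mul0r mulr0.
Qed.

Lemma OA_half_strength_bound (n N : nat) (C : {mset n.-tuple bool}) :
  (0 < n)%N -> ~~ odd n -> orthogonal_array N (n %/ 2 - 1)%N C ->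
  2 ^+ n <= 2 * n%:R * N%:R :> rat.
Proof.
move=> n_gt0 n_even OA; have [Cn0 sizeC _] := OA.
pose F := char_sum (fun x : n.-tuple bool => tnth x) C.
pose y := char_sum (fun i : 'I_n => eq_op i) (enum 'I_n).
have N_gt0 : 0 < N%:R :> rat.
  rewrite ltr0n -sizeC lt0n; apply/eqP => /size0nil C0; apply: Cn0.
  by apply/msetP => x; rewrite mset0E -count_mem_mset C0.
have nR_gt0 : 0 < n%:R :> rat by rewrite ltr0n.
have P1 := posdef1 n.
have yP G : posdef G -> posdef (fun u => y u * G u) by apply: posdef_char_sum.
have FP G : posdef G -> posdef (fun u => F u * G u) by apply: posdef_char_sum.
(* [M1] and [M3] bound the sums of $F^2y$ and $F^2y^3$ below by 0; [M2] and [M0] together bound that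
   of $F^2y^2$ below by $N \cdot n2^n$. *)
have M1 := posdef_sum_ge0 _ _ (FP _ (FP _ (yP _ P1))).
have M3 := posdef_sum_ge0 _ _ (FP _ (FP _ (yP _ (yP _ (yP _ P1))))).
have M2 := char_sum_sqr_ge n _ (fun x : n.-tuple bool => tnth x) C _ (yP _ (yP _ P1)).
have M0 := char_sum_sqr_ge n _ (fun i : 'I_n => eq_op i) (enum 'I_n) _ P1.
rewrite size_enum_ord sumr_const card_ffun card_bool card_ord in M0.
rewrite sizeC -/F in M2; rewrite -/y natrX in M0.
have upper : \sum_u F u ^+ 2 * (y u * (y u + n%:R) ^+ 2)
    <= N%:R ^+ 2 * (n%:R * (n%:R + n%:R) ^+ 2).
  rewrite (bigD1 [ffun=> false]) //= -[leRHS]addr0; apply: lerD.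
    have -> : y [ffun=> false] = n%:R.
      rewrite /y char_sum_units (_ : [set _ | _] = set0) ?cards0 ?mulr0 ?subr0 //.
      by apply/setP=> i; rewrite !inE ffunE.
    have -> // : F [ffun=> false] = N%:R.
    rewrite /F /char_sum -sizeC -[RHS]mulr_natl mulr1 -sum1_size natr_sum.
    apply: eq_bigr => x _; rewrite /cube_char big1 // => i _.
    by rewrite ffunE andbF.
  apply: sumr_le0 => u u_neq0; set U := [set i | u i].
  have U_gt0 : (0 < #|U|)%N.
    rewrite card_gt0; apply: contra_neq u_neq0 => U0; apply/ffunP=> i.
    by have := in_set0 i; rewrite -U0 inE ffunE.
  (* Low weights are killed by the strength; otherwise $|U| \ge n/2$, and evenness of [n] gives
     $2|U| \ge n$, so $y \le 0$. *)
  have [U_le|U_ge] := leqP #|U| (n %/ 2 - 1).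
    rewrite /F (OA_char_sum_eq0 N n _ C u _ OA) ?U_gt0 //; last by lia.
    by rewrite expr0n mul0r.
  apply: mulr_ge0_le0; first exact: sqr_ge0.
  apply: mulr_le0_ge0; last exact: sqr_ge0.
  rewrite /y char_sum_units subr_le0 -natrM ler_nat -/U.
  by move: n_even U_ge; lia.
have expand : \sum_u F u ^+ 2 * (y u * (y u + n%:R) ^+ 2)
  = \sum_u F u * (F u * (y u * (y u * (y u * 1))))
    + 2 * n%:R * \sum_u F u * (F u * (y u * (y u * 1)))
    + n%:R ^+ 2 * \sum_u F u * (F u * (y u * 1)).
  by rewrite !mulr_sumr -!big_split; apply: eq_bigr => u _ /=; ring.
have M1' := mulr_ge0 (sqr_ge0 n%:R) M1.
have M02 : N%:R * (n%:R * 2 ^+ n) <= \sum_u F u * (F u * (y u * (y u * 1))).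
  by apply: le_trans M2; rewrite ler_pM2l.
have M02' : 2 * n%:R * (N%:R * (n%:R * 2 ^+ n))
    <= 2 * n%:R * \sum_u F u * (F u * (y u * (y u * 1))).
  by rewrite ler_pM2l // mulr_gt0.
(* The common factor of $2n^2N\,2^n \le 4n^3N^2$, to be cancelled. *)
have c_gt0 : 0 < 2 * n%:R ^+ 2 * N%:R :> rat by rewrite !mulr_gt0 // exprn_gt0.
rewrite -(ler_pM2l c_gt0).
have -> : 2 * n%:R ^+ 2 * N%:R * (2 * n%:R * N%:R) =
  N%:R ^+ 2 * (n%:R * (n%:R + n%:R) ^+ 2) :> rat by ring.
have -> : 2 * n%:R ^+ 2 * N%:R * 2 ^+ n = 2 * n%:R * (N%:R * (n%:R * 2 ^+ n)) :> rat
  by ring.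
rewrite expand in upper; lra.
Qed.

Theorem mainTheorem6 (n N : nat) (n_gt0 : (0 < n)%N) (n_even : ~~ odd n)
    (OA_ex : exists C : {mset n.-tuple bool},
       orthogonal_array N (n %/ 2 - 1)%N C) :
  (N%:R : rat) > (409 / 1000) / n%:R * 2 ^+ n.
Proof.
have [C OA] := OA_ex.
have bound := OA_half_strength_bound n N C n_gt0 n_even OA.
have nR_gt0 : 0 < n%:R :> rat by rewrite ltr0n.
have pow_gt0 : 0 < 2 ^+ n :> rat by rewrite exprn_gt0.
move: bound nR_gt0 pow_gt0.
move: (N%:R : rat) (n%:R : rat) (2 ^+ n : rat) => x y z bound y_gt0 z_gt0.
(* The bound gives the constant $1/2 > 0.409$; strictness uses $2^n > 0$. *)
rewrite mulrAC ltr_pdivrMr; lra.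
Qed.
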